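(* Fix a finite set of processes $\mathcal{P}$ and a finite set of message labels $\mathcal{C}$. Let $\mathsf{LC}$ be the class of all MSGs $G$ (over $\mathcal{P},\mathcal{C}$) for which there exists a local-choice MSG $G'$ with $\mathcal{L}(G)=\mathcal{L}(G')$, and let $\mathsf{CC}$ be the class of all MSGs $G$ for which there exists a controllable-choice MSG $G'$ with $\mathcal{L}(G)=\mathcal{L}(G')$. Then $\mathsf{LC}$ is a proper subset of $\mathsf{CC}$, i.e. $\mathsf{LC}\subseteq\mathsf{CC}$ and $\mathsf{CC}\setminus\mathsf{LC}\neq\emptyset$.
   Context: A basic Message Sequence Chart (bMSC) is a tuple $M=(E,<,\mathcal{P},\mathcal{T},P,\mathcal{M},l)$ where $E$ is a finite set of events, $\mathcal{T}:E\to\{\mathrm{send},\mathrm{receive}\}$, $P:E\to\mathcal{P}$ assigns each event a process, $\mathcal{M}:\mathcal{T}^{-1}(\mathrm{send})\to\mathcal{T}^{-1}(\mathrm{receive})$ is a bijection with $P(e)\neq P(\mathcal{M}(e))$ (a pair $(e,\mathcal{M}(e))$ is a message), $l$ assigns each message a label in $\mathcal{C}$, and the visual order $<$ is the reflexive-transitive closure of $\mathcal{M}\cup\bigcup_{p}<_p$ where $<_p$ is a total order on $P^{-1}(p)$; $<$ is required to be a partial order, and the bMSC must be FIFO: for messages $(e,f),(e',f')$, if $e<_p e'$ and $P(f)=P(f')=p'$ then $f<_{p'}f'$. Events are written as letters of $\Sigma=\{p!q(m)\}\cup\{q?p(m)\}$ ($p!q(m)$: $p$ sends label $m$ to $q$;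 $q?p(m)$: $q$ receives label $m$ from $p$). A linearization of $M$ is a word over $\Sigma$ listing all events of $M$ in a total order consistent with $<$; $\mathcal{L}(M)$ is the set of linearizations. The (weak) sequential composition $M_1\cdot M_2$ of bMSCs with disjoint event sets is the union of the two bMSCs with order the transitive closure of $<_1\cup<_2\cup\bigcup_p (P_1^{-1}(p)\times P_2^{-1}(p))$. A Message Sequence Graph (MSG) is $G=(\mathcal{S},\tau,s_0,s_f,L)$ with finite state set $\mathcal{S}$, edge relation $\tau\subseteq\mathcal{S}\times\mathcal{S}$, initial state $s_0$ with no incoming edges, terminal state $s_f$ with no outgoing edges, every node reachable from $s_0$ and $s_f$ reachable from every node, and $L$ labeling each node by a bMSC. A path is $s_1\dots s_k$ with $(s_i,s_{i+1})\in\tau$; a run is a path from $s_0$ to $s_f$; $L(s_1\dots s_k)=L(s_1)\cdot\ldots\cdot L(s_k)$; $\mathcal{L}(G)=\bigcup_{\sigma\text{ run}}\mathcal{L}(L(\sigma))$. A process $p$ initiates a bMSC $M$ if some event $e$ of $M$ with $P(e)=p$ has no event $e'\neq e$ of $M$ with $e'<e$. For a node $s$, $\mathrm{triggers}(s)$ is the set of processes $p$ such that there is a (nonempty) path $\sigma=\sigma_1\dots\sigma_n$ with $(s,\sigma_1)\in\tau$ and $p$ initiates $L(\sigma)$. A choice node is a node with more than one outgoing edge. A choice node $u$ is local-choice iff $\mathrm{triggers}(u)$ is a singleton; an MSG is local-choice iff all its choice nodes are local-choice. For a bMSC $M$ and $P'\subseteq\mathcal{P}$, a send event $e$ of $M$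 is a resolving event for $P'$ iff for every $p\in P'$ there is an event $e_p$ of $M$ on process $p$ with $e<e_p$ (visual order). A choice node $u$ is controllable-choice iff (i) for every path $\sigma$ from $s_0$ to $u$, $L(\sigma)$ contains a resolving event for $\mathrm{triggers}(u)$, and (ii) for every path $\sigma=s_1s_2\dots u$ with $(u,s_1)\in\tau$, $L(\sigma)$ contains a resolving event for $\mathrm{triggers}(u)$. An MSG is controllable-choice iff each of its choice nodes is local-choice or controllable-choice.
   Formalization: Strictness (CC \ LC nonempty) is stated for at least two processes and at least one message label; otherwise every bMSC is empty, every MSG has language {ε}, and LC = CC. The inclusion LC ⊆ CC is stated for all finite sets of processes and labels. *)

(* Defs.v *)
From mathcomp Require Import all_boot.

Set Implicit Arguments.
Unset Strict Implicit.
Unset Printing Implicit Defensive.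

(* [Snd p q m] is the letter p!q(m) and [Rcv q p m] is the letter q?p(m). *)
Inductive letter (P C : Type) : Type :=
| Snd of P & P & C
| Rcv of P & P & C.
Arguments Snd {P C} _ _ _.
Arguments Rcv {P C} _ _ _.

(* [connect] is the reflexive-transitive closure. *)
Definition visual_order (E : finType) (send : pred E) (msg : E -> E)
    (ple : rel E) : rel E :=
  connect (fun e f => (send e && (msg e == f)) || ple e f).

(* The set of processes is the whole type P and the set of labels the whole
   type C.
   - [is_send] is the type function: an event that is not a send is a receive.
   - [msg] is the matching.  It is total for convenience, but is only
     constrained (and only used) on sends, where it is a bijection onto the
     receives.  Likewise [lab e] is the label of the message (e, msg e) and is
     only used at a send e.
   - [ple] is the union over p of the total orders <_p; since these live on the
     pairwise disjoint sets proc^-1(p), the union determines each of them. *)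
Record bMSC (P C : finType) : Type := BMSC {
  event : finType;
  is_send : pred event;
  proc : event -> P;
  msg : event -> event;
  lab : event -> C;
  ple : rel event;
  msg_recv : forall e, is_send e -> ~~ is_send (msg e);
  msg_inj : {in is_send &, injective msg};
  msg_surj : forall f, ~~ is_send f -> exists2 e, is_send e & msg e = f;
  msg_proc : forall e, is_send e -> proc e != proc (msg e);
  ple_proc : forall e f, ple e f -> proc e = proc f;
  ple_total : forall e f, proc e = proc f -> ple e f || ple f e;
  ple_anti : antisymmetric ple;
  ple_trans : transitive ple;
  visual_anti : antisymmetric (visual_order is_send msg ple);
  fifo : forall e e', is_send e -> is_send e' -> ple e e' ->
    proc (msg e) = proc (msg e') -> ple (msg e) (msg e')
}.

Arguments event {P C} _.
Arguments is_send {P C} _ _.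
Arguments proc {P C} _ _.
Arguments msg {P C} _ _.
Arguments lab {P C} _ _.
Arguments ple {P C} _ _ _.

Definition vle (P C : finType) (M : bMSC P C) : rel (event M) :=
  visual_order (@is_send _ _ M) (@msg _ _ M) (@ple _ _ M).

(* For a receive f the pick succeeds, and its result is unique. *)
Definition sender (P C : finType) (M : bMSC P C) (f : event M) : event M :=
  odflt f [pick e | is_send M e && (msg M e == f)].

Definition event_letter (P C : finType) (M : bMSC P C) (e : event M) :
    letter P C :=
  if is_send M e then Snd (proc M e) (proc M (msg M e)) (lab M e)
  else Rcv (proc M e) (proc M (sender e)) (lab M (sender e)).

Definition linearization (P C : finType) (M : bMSC P C)
    (w : seq (letter P C)) : Prop :=
  exists s : seq (event M),
    [/\ uniq s, forall e, e \in s,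
        forall e f, vle e f -> index e s <= index f s
      & w = [seq event_letter e | e <- s]].

(* The disjoint sum makes the two sets of events disjoint, including when a
   bMSC is composed with itself. *)
Definition seq_ple (P C : finType) (M1 M2 : bMSC P C) :
    rel (event M1 + event M2) :=
  fun x y => match x, y with
  | inl e, inl f => ple M1 e f
  | inr e, inr f => ple M2 e f
  | inl e, inr f => proc M1 e == proc M2 f
  | inr _, inl _ => false
  end.

Definition seq_is_send (P C : finType) (M1 M2 : bMSC P C) :
    pred (event M1 + event M2) :=
  fun x => match x with inl e => is_send M1 e | inr e => is_send M2 e end.

Definition seq_proc (P C : finType) (M1 M2 : bMSC P C)
    (x : event M1 + event M2) : P :=
  match x with inl e => proc M1 e | inr e => proc M2 e end.

Definition seq_msg (P C : finType) (M1 M2 : bMSC P C)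
    (x : event M1 + event M2) : event M1 + event M2 :=
  match x with inl e => inl (msg M1 e) | inr e => inr (msg M2 e) end.

Definition seq_lab (P C : finType) (M1 M2 : bMSC P C)
    (x : event M1 + event M2) : C :=
  match x with inl e => lab M1 e | inr e => lab M2 e end.

Definition seq_vle (P C : finType) (M1 M2 : bMSC P C) :
    rel (event M1 + event M2) :=
  visual_order (@seq_is_send _ _ M1 M2) (@seq_msg _ _ M1 M2)
    (@seq_ple _ _ M1 M2).

Lemma seq_msg_recv (P C : finType) (M1 M2 : bMSC P C) x :
  @seq_is_send _ _ M1 M2 x -> ~~ @seq_is_send _ _ M1 M2 (seq_msg x).
Proof. by case: x => e; apply: msg_recv. Qed.

Lemma seq_msg_inj (P C : finType) (M1 M2 : bMSC P C) :
  {in @seq_is_send _ _ M1 M2 &, injective (@seq_msg _ _ M1 M2)}.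
Proof.
by move=> [e|e] [f|f] // he hf [] /(msg_inj he hf) ->.
Qed.

Lemma seq_msg_surj (P C : finType) (M1 M2 : bMSC P C) x :
  ~~ @seq_is_send _ _ M1 M2 x ->
  exists2 y, @seq_is_send _ _ M1 M2 y & seq_msg y = x.
Proof.
case: x => f /= /msg_surj[e he <-]; first by exists (inl e).
by exists (inr e).
Qed.

Lemma seq_msg_proc (P C : finType) (M1 M2 : bMSC P C) x :
  @seq_is_send _ _ M1 M2 x -> seq_proc x != seq_proc (seq_msg x).
Proof. by case: x => e; apply: msg_proc. Qed.

Lemma seq_ple_proc (P C : finType) (M1 M2 : bMSC P C) x y :
  @seq_ple _ _ M1 M2 x y -> seq_proc x = seq_proc y.
Proof. by case: x y => e [] f //=; [apply: ple_proc|move/eqP|apply: ple_proc]. Qed.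

Lemma seq_ple_total (P C : finType) (M1 M2 : bMSC P C) x y :
  seq_proc x = seq_proc y -> @seq_ple _ _ M1 M2 x y || seq_ple y x.
Proof.
case: x y => e [] f /=; try exact: ple_total.
- by move=> ->; rewrite eqxx.
- by move=> ->; rewrite eqxx.
Qed.

Lemma seq_ple_anti (P C : finType) (M1 M2 : bMSC P C) :
  antisymmetric (@seq_ple _ _ M1 M2).
Proof.
by move=> [e|e] [f|f] //=; rewrite ?andbF // => /ple_anti ->.
Qed.

Lemma seq_ple_trans (P C : finType) (M1 M2 : bMSC P C) :
  transitive (@seq_ple _ _ M1 M2).
Proof.
move=> [y|y] [x|x] [z|z] //=; try exact: ple_trans.
- by move=> /ple_proc ->.
- by move=> /eqP -> /ple_proc ->.
Qed.

Lemma seq_vle_cases (P C : finType) (M1 M2 : bMSC P C) x y :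
  @seq_vle _ _ M1 M2 x y ->
  match x, y with
  | inl e, inl f => vle e f
  | inr e, inr f => vle e f
  | inl _, inr _ => true
  | inr _, inl _ => false
  end.
Proof.
case/connectP => s; elim: s x => [|z s IHs] x /=.
  by move=> _ ->; case: x => e; apply: connect0.
case/andP => xz zs ys; move: (IHs _ zs ys) => {IHs zs ys}.
case: x xz => e; case: z => f //=; case: y => g //= efs.
- by apply: connect_trans; apply: connect1; exact: efs.
- by rewrite andbF in efs.
- by rewrite andbF in efs.
- by apply: connect_trans; apply: connect1; exact: efs.
Qed.

Lemma seq_vle_anti (P C : finType) (M1 M2 : bMSC P C) :
  antisymmetric (@seq_vle _ _ M1 M2).
Proof.
move=> x y /andP[/seq_vle_cases xy /seq_vle_cases yx].
case: x y xy yx => e [] f //= ef fe; congr (_ _);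
  by apply: visual_anti; apply/andP.
Qed.

Lemma seq_fifo (P C : finType) (M1 M2 : bMSC P C) x y :
  @seq_is_send _ _ M1 M2 x -> seq_is_send y -> seq_ple x y ->
  seq_proc (seq_msg x) = seq_proc (seq_msg y) ->
  seq_ple (seq_msg x) (seq_msg y).
Proof.
case: x y => e [] f //=; try exact: fifo.
by move=> _ _ _ /eqP.
Qed.

Definition bmsc_seq (P C : finType) (M1 M2 : bMSC P C) : bMSC P C :=
  BMSC (@seq_lab _ _ M1 M2)
    (@seq_msg_recv _ _ M1 M2) (@seq_msg_inj _ _ M1 M2)
    (@seq_msg_surj _ _ M1 M2) (@seq_msg_proc _ _ M1 M2)
    (@seq_ple_proc _ _ M1 M2) (@seq_ple_total _ _ M1 M2)
    (@seq_ple_anti _ _ M1 M2) (@seq_ple_trans _ _ M1 M2)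
    (@seq_vle_anti _ _ M1 M2) (@seq_fifo _ _ M1 M2).

(* The visual order of the composition is the closure of the two visual orders
   together with all pairs of P1^-1(p) x P2^-1(p). *)
Lemma vle_bmsc_seq (P C : finType) (M1 M2 : bMSC P C) :
  @vle _ _ (bmsc_seq M1 M2) =2
  connect (fun x y : event M1 + event M2 => match x, y with
    | inl e, inl f => vle e f
    | inr e, inr f => vle e f
    | inl e, inr f => proc M1 e == proc M2 f
    | inr _, inl _ => false
    end).
Proof.
move=> x y; apply/idP/idP; apply: connect_sub => {x y} [[e|e] [f|f]] //= ef.
- by apply: connect1; apply: connect1.
- by rewrite andbF in ef; apply: connect1.
- by rewrite andbF in ef.
- by apply: connect1; apply: connect1.
- case/connectP: ef => s; elim: s e => [|g s IHs] e /=.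
    by move=> _ ->; apply: connect0.
  case/andP => eg gs fs; apply: connect_trans (IHs _ gs fs).
  by apply: connect1.
- by apply: connect1; rewrite /= ef orbT.
- case/connectP: ef => s; elim: s e => [|g s IHs] e /=.
    by move=> _ ->; apply: connect0.
  case/andP => eg gs fs; apply: connect_trans (IHs _ gs fs).
  by apply: connect1.
Qed.

(* [connect edge] is reflexive, so [init] counts as reachable from itself. *)
Record MSG (P C : finType) : Type := Msg {
  state : finType;
  edge : rel state;
  init : state;
  final : state;
  label : state -> bMSC P C;
  init_no_in : forall s, ~~ edge s init;
  final_no_out : forall s, ~~ edge final s;
  init_reach : forall s, connect edge init s;
  final_reach : forall s, connect edge s final
}.

Arguments state {P C} _.
Arguments edge {P C} _ _ _.
Arguments init {P C} _.
Arguments final {P C} _.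
Arguments label {P C} _ _.

(* As in [path], the nonempty path s_1 ... s_k is given by its head s_1 and the
   sequence r of the remaining nodes; it ends at [last s_1 r]. *)
Fixpoint path_label (P C : finType) (G : MSG P C) (s : state G)
    (r : seq (state G)) : bMSC P C :=
  if r is t :: r' then bmsc_seq (label G s) (path_label t r') else label G s.

Definition language (P C : finType) (G : MSG P C) (w : seq (letter P C)) :
    Prop :=
  exists r : seq (state G),
    [/\ path (edge G) (init G) r, last (init G) r = final G
      & linearization (path_label (init G) r) w].

Definition same_language (P C : finType) (G G' : MSG P C) : Prop :=
  forall w, language G w <-> language G' w.

Definition initiates (P C : finType) (M : bMSC P C) (p : P) : Prop :=
  exists e : event M, proc M e = p /\ forall e', vle e' e -> e' = e.

Definition triggers (P C : finType) (G : MSG P C) (s : state G) (p : P) :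
    Prop :=
  exists (s1 : state G) (r : seq (state G)),
    [/\ edge G s s1, path (edge G) s1 r & initiates (path_label s1 r) p].

Definition choice_node (P C : finType) (G : MSG P C) (u : state G) : bool :=
  1 < #|[pred t | edge G u t]|.

Definition local_choice_node (P C : finType) (G : MSG P C) (u : state G) :
    Prop :=
  exists p, forall q, triggers u q <-> q = p.

Definition local_choice (P C : finType) (G : MSG P C) : Prop :=
  forall u : state G, choice_node u -> local_choice_node u.

(* The visual order is reflexive, so a send resolves for its own process. *)
Definition resolving (P C : finType) (M : bMSC P C) (P' : P -> Prop)
    (e : event M) : Prop :=
  is_send M e /\
  forall p, P' p -> exists ep : event M, proc M ep = p /\ vle e ep.

Definition controllable_choice_node (P C : finType) (G : MSG P C)
    (u : state G) : Prop :=
  (forall r, path (edge G) (init G) r -> last (init G) r = u ->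
     exists e, @resolving _ _ (path_label (init G) r) (triggers u) e) /\
  (forall s1 r, edge G u s1 -> path (edge G) s1 r -> last s1 r = u ->
     exists e, @resolving _ _ (path_label s1 r) (triggers u) e).

Definition controllable_choice (P C : finType) (G : MSG P C) : Prop :=
  forall u : state G, choice_node u ->
    local_choice_node u \/ controllable_choice_node u.

Definition LC (P C : finType) (G : MSG P C) : Prop :=
  exists G' : MSG P C, local_choice G' /\ same_language G G'.

Definition CC (P C : finType) (G : MSG P C) : Prop :=
  exists G' : MSG P C, controllable_choice G' /\ same_language G G'.

(* Main.v *)
(* Let X be the crossing bMSC: a and b each send to the other, both before
   receiving.  In a graph whose nodes are all labelled by X, every path starts
   with a send of a that resolves for {a, b}, so every choice is controllable.
   Take such a graph with language L(XX) + L(XXX), and suppose that G' has the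
   same language and is local-choice.  Cut a run of G' at a choice node.  In the
   words of the language the events of each process alternate between sends and
   receives, starting with a send; the part before the cut has as many sends as
   receives, so it has an even number of events on each process.  Hence in the
   part after the cut each active process starts with a send, and so initiates
   it; if that part is nonempty, it contains a message and thus has two
   initiators.  This contradicts local choice, so G' has no choice node, has a
   single run, and all words of its language have the same length. *)
Require Import Defs.
From mathcomp Require Import all_boot.
From mathcomp Require Import zify.

Set Implicit Arguments.
Unset Strict Implicit.
Unset Printing Implicit Defensive.

(** * Letters, and linearizations of bMSCs and of their compositions *)

Definition letter_proc (P C : Type) (l : letter P C) : P :=
  match l with Snd p _ _ | Rcv p _ _ => p end.

Definition letter_send (P C : Type) (l : letter P C) : bool :=
  if l is Snd _ _ _ then true else false.

Section BMSC.
Variables P C : finType.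
Implicit Type M : bMSC P C.

Lemma letter_proc_event M (e : event M) : letter_proc (event_letter e) = proc M e.
Proof. by rewrite /event_letter; case: ifP. Qed.

Lemma letter_send_event M (e : event M) : letter_send (event_letter e) = is_send M e.
Proof. by rewrite /event_letter; case: ifP. Qed.

Lemma senderP M (f : event M) : ~~ is_send M f ->
  is_send M (sender f) /\ msg M (sender f) = f.
Proof.
move=> /msg_surj [e se ef]; rewrite /sender; case: pickP => [g /andP[? /eqP]|] //.
by move=> /(_ e); rewrite se ef eqxx.
Qed.

Lemma sender_msg M (e : event M) : is_send M e -> sender (msg M e) = e.
Proof.
move=> se; have [ss ms] := senderP (msg_recv se).
exact: msg_inj ms.
Qed.

Lemma event_letter_inl M1 M2 (e : event M1) :
  @event_letter _ _ (bmsc_seq M1 M2) (inl e) = event_letter e.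
Proof.
rewrite /event_letter /=; case: ifPn => // /senderP [ss ms].
have -> // : @sender _ _ (bmsc_seq M1 M2) (inl e) = inl (sender e).
by rewrite -[in LHS]ms; apply: (@sender_msg (bmsc_seq M1 M2) (inl (sender e))).
Qed.

Lemma event_letter_inr M1 M2 (e : event M2) :
  @event_letter _ _ (bmsc_seq M1 M2) (inr e) = event_letter e.
Proof.
rewrite /event_letter /=; case: ifPn => // /senderP [ss ms].
have -> // : @sender _ _ (bmsc_seq M1 M2) (inr e) = inr (sender e).
by rewrite -[in LHS]ms; apply: (@sender_msg (bmsc_seq M1 M2) (inr (sender e))).
Qed.

Lemma vle_trans M : transitive (@vle _ _ M).
Proof. by move=> f e g; apply: connect_trans. Qed.

Lemma ple_vle M (e f : event M) : ple M e f -> vle e f.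
Proof. by move=> ef; apply: connect1; rewrite /= ef orbT. Qed.

Lemma msg_vle M (e : event M) : is_send M e -> vle e (msg M e).
Proof. by move=> se; apply: connect1; rewrite /= se eqxx. Qed.

(** Events are sorted by the size of their down-set in the visual order, which grows strictly along
    that order by antisymmetry. *)
Lemma linearization_exists M : exists w, linearization M w.
Proof.
pose down (e : event M) := #|[pred f | vle f e]|.
pose s := sort (fun e f => down e <= down f) (enum (event M)).
have ins e : e \in s by rewrite mem_sort mem_enum.
exists [seq event_letter e | e <- s], s; split=> //.
  by rewrite sort_uniq enum_uniq.
move=> e f ef; rewrite leqNgt; apply/negP => lt_fe.
have: down f <= down e.
  pose le_down e f := down e <= down f.
  apply: (sorted_ltn_index (leT := le_down) _ _ f e (ins f) (ins e) lt_fe).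
    by move=> ? ? ?; apply: leq_trans.
  by apply: sort_sorted => ? ?; apply: leq_total.
(* The down-set of [e] is proper in that of [f]: it misses [f] itself. *)
rewrite leqNgt => /negP; apply; apply: proper_card; apply/properP; split.
  by apply/subsetP => g; rewrite !inE => ge; apply: vle_trans ge ef.
exists f; rewrite !inE; first exact: connect0.
apply/negP => fe.
have Eef: e = f by apply: (@visual_anti _ _ M); apply/andP.
by rewrite Eef ltnn in lt_fe.
Qed.

Lemma linearization_seq M1 M2 w1 w2 : linearization M1 w1 ->
  linearization M2 w2 -> linearization (bmsc_seq M1 M2) (w1 ++ w2).
Proof.
move=> [s1 [u1 m1 i1 ->]] [s2 [u2 m2 i2 ->]].
pose il e : event (bmsc_seq M1 M2) := inl e.
pose ir e : event (bmsc_seq M1 M2) := inr e.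
have il_inj : injective il by move=> ? ? [].
have ir_inj : injective ir by move=> ? ? [].
have ir_il t e : ir e \in [seq il x | x <- t] = false by apply/negP => /mapP [].
exists ([seq il x | x <- s1] ++ [seq ir x | x <- s2]).
have idl e : index (il e) ([seq il x | x <- s1] ++ [seq ir x | x <- s2]) = index e s1.
  by rewrite index_cat map_f // index_map.
have idr e : index (ir e) ([seq il x | x <- s1] ++ [seq ir x | x <- s2])
    = size s1 + index e s2.
  by rewrite index_cat ir_il size_map index_map.
split.
- rewrite cat_uniq !map_inj_uniq // u1 u2 andbT.
  by apply/hasPn => _ /mapP [y _ ->]; exact: negbT (ir_il s1 y).
- by move=> [e|e]; rewrite mem_cat; apply/orP; [left|right]; apply: map_f.
- move=> x y /seq_vle_cases; case: x y => [e|e] [f|f] // ef.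
  + by rewrite (idl e) (idl f) i1.
  + by rewrite (idl e) (idr f) (leq_trans (index_size _ _)) // leq_addr.
  + by rewrite (idr e) (idr f) leq_add2l i2.
- rewrite map_cat -!map_comp; congr (_ ++ _); apply: eq_map => e /=.
    by rewrite event_letter_inl.
  by rewrite event_letter_inr.
Qed.

Lemma linearization_perm M (s : seq (event M)) : uniq s -> (forall e, e \in s) ->
  perm_eq s (enum (event M)).
Proof.
by move=> us ms; apply: uniq_perm => // [|e]; rewrite ?enum_uniq ?ms ?mem_enum.
Qed.

Lemma size_linearization M w : linearization M w -> size w = #|event M|.
Proof.
move=> [s [us ms _ ->]].
by rewrite size_map cardE; apply: perm_size; apply: linearization_perm.
Qed.

(** Matching is a bijection from sends to receives, so exactly half of the letters are sends. *)
Lemma linearization_balanced M w : linearization M w ->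
  (count (@letter_send P C) w).*2 = size w.
Proof.
move=> lw; rewrite (size_linearization lw); case: lw => [s [us ms _ ->]].
rewrite count_map (eq_count (@letter_send_event M)).
rewrite (permP (linearization_perm us ms)) enumT -size_filter.
have -> : size [seq e <- Finite.enum (event M) | is_send M e] = #|is_send M|.
  by rewrite cardE.
suff E : #|[pred e | ~~ is_send M e]| = #|is_send M|.
  by rewrite -addnn -{2}E -(cardC (is_send M)).
rewrite -(card_in_imset (@msg_inj _ _ M)); apply: eq_card => f.
apply/idP/imsetP => [/msg_surj [e se <-]|[e se ->]]; first by exists e.
exact: msg_recv.
Qed.

End BMSC.

(** * Words and bMSCs in which each process alternates, starting with a send *)

Section AlternatingWords.
Variables P C : finType.
Implicit Types (w u v : seq (letter P C)) (l : letter P C) (x : P).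

Definition on_proc x : pred (letter P C) := fun l => letter_proc l == x.

Definition alternating w : Prop := forall u l v, w = u ++ l :: v ->
  letter_send l = ~~ odd (count (on_proc (letter_proc l)) u).

Lemma alternating_prefix u v : alternating (u ++ v) -> alternating u.
Proof. by move=> A u1 l u2 E; apply: (A _ _ (u2 ++ v)); rewrite E -catA. Qed.

(** On one process the sends equal the receives in number, or exceed them by one when the process
    has an odd number of letters. The sum collects these excesses. *)
Lemma alternating_sends w : alternating w ->
  (count (@letter_send P C) w).*2 = size w + \sum_x odd (count (on_proc x) w).
Proof.
elim/last_ind: w => [|w l IHw] A; first by rewrite big1.
rewrite -cats1 in A *; have {}IHw := IHw (alternating_prefix A).
have sl := A w l [::] erefl.
rewrite count_cat /= addn0 doubleD {}IHw size_cat /= addn1.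
rewrite (bigD1 (letter_proc l)) //= [in RHS](bigD1 (letter_proc l)) //=.
rewrite [in RHS](eq_bigr (fun x => odd (count (on_proc x) w) : nat)).
  rewrite count_cat /= addn0 /on_proc eqxx addn1 /= sl.
  rewrite -/(on_proc (letter_proc l)).
  by case: odd => /=; lia.
by move=> x nx; rewrite count_cat /= /on_proc eq_sym (negPf nx) !addn0.
Qed.

(** Balance of [w1] makes the sum of excesses zero, so every process has an even number of letters
    in [w1] and removing [w1] changes no parity. *)
Lemma alternating_suffix w1 w2 : alternating (w1 ++ w2) ->
  (count (@letter_send P C) w1).*2 = size w1 -> alternating w2.
Proof.
move=> A /eqP; rewrite (alternating_sends (alternating_prefix A)).
rewrite -[X in _ == X]addn0 eqn_add2l sum_nat_eq0 => /forallP even1 u l v E.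
rewrite (A (w1 ++ u) l v); last by rewrite E catA.
by rewrite count_cat oddD; have := even1 (letter_proc l); case: odd.
Qed.

(** The first event of a process in the word is a send. Nothing lies below it: a message edge ends
    in a receive, and its process has no earlier event. *)
Lemma alternating_initiates (M : bMSC P C) w : linearization M w -> alternating w ->
  forall e, initiates M (proc M e).
Proof.
move=> [s [us ms is_ ->]] A e.
case: (@arg_minnP _ e (fun f => proc M f == proc M e) (fun f => index f s)) => //.
move=> f /eqP fe fmin.
have sf : is_send M f.
  case/splitPr: {2}s / (ms f) (erefl s) => s1 s2 Es.
  have := A [seq event_letter g | g <- s1] (event_letter f)
    [seq event_letter g | g <- s2].
  rewrite Es map_cat => /(_ erefl); rewrite letter_send_event => ->.
  rewrite letter_proc_event count_map (eq_in_count (a2 := pred0)) ?count_pred0 //.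
  move=> g g1 /=; rewrite /on_proc letter_proc_event fe; apply/negbTE/negP => /fmin.
  move: us; rewrite Es cat_uniq /= => /andP[_ /andP[/norP [f1 _] _]].
  rewrite !index_cat g1 (negPf f1) /= eqxx addn0 leqNgt index_mem g1.
  by [].
exists f; split=> // g /connectP [p pth].
(* The path into [f] is shortened from its end: its last edge cannot be a message, and an edge of
   [ple] can only be a loop at [f]. *)
elim/last_ind: p pth => [|p y IHp] //=; rewrite rcons_path last_rcons.
move=> /andP[pth st] Ey; subst y; apply: IHp => //.
case/orP: st => [/andP[/msg_recv sg /eqP Ef]|le_gf]; first by rewrite Ef sf in sg.
have: index (last g p) s = index f s.
  apply/eqP; rewrite eqn_leq is_ ?fmin ?(ple_proc le_gf) ?fe //.
  exact: ple_vle.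
by move=> E; rewrite -(nth_index f (ms f)) -(nth_index f (ms (last g p))) E.
Qed.

(** The count includes [e] itself, so the first event of a process has count 1 and is a send. *)
Definition alternating_msc (M : bMSC P C) : Prop :=
  forall e, is_send M e = odd #|[pred f | ple M f e]|.

Definition even_msc (M : bMSC P C) : Prop :=
  forall x, ~~ odd #|[pred e | proc M e == x]|.

(** The letters before [e] on its process come exactly from the events strictly below [e] in
    [ple]. *)
Lemma alternating_linearization (M : bMSC P C) w :
  alternating_msc M -> linearization M w -> alternating w.
Proof.
move=> A [s [us ms is_ ->]] u l v Ew.
have := congr1 (take (size u)) Ew; rewrite take_size_cat // -map_take => <-.
have := congr1 (drop (size u)) Ew; rewrite drop_size_cat // -map_drop.
have := cat_take_drop (size u) s; set s1 := take _ _.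
case: drop => //= e s2 Es [<- _]; rewrite letter_send_event letter_proc_event A.
rewrite cardE /enum_mem size_filter -enumT -(permP (linearization_perm us ms)).
have := us; rewrite -Es cat_uniq /= => /and4P[_ /norP [e1 s21] e2 _].
have idx_e : index e s = size s1 by rewrite -Es index_cat (negPf e1) /= eqxx addn0.
rewrite count_cat /= [X in _ + X]addnC.
have -> : count (mem [pred f | ple M f e]) s2 = 0.
  rewrite (eq_in_count (a2 := pred0)) ?count_pred0 // => f f2 /=.
  apply/negbTE/negP => /ple_vle /is_; rewrite idx_e -Es index_cat.
  rewrite (negPf (hasPn s21 f f2)) /=; case: eqP => [Ef|_].
    by rewrite Ef f2 in e2.
  by rewrite addnS ltnNge leq_addr.
(* The event [e] counts itself, which accounts for the negation in [alternating]. *)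
rewrite inE /= (_ : ple M e e); last by have := @ple_total _ _ M e e erefl; rewrite orbb.
rewrite add0n addn1 /= count_map; congr (~~ odd _); apply: eq_in_count => f f1 /=.
rewrite /on_proc letter_proc_event; apply/idP/eqP => [/ple_proc //|/ple_total].
case/orP => // /ple_vle /is_; rewrite idx_e -Es index_cat f1.
by rewrite leqNgt index_mem f1.
Qed.

Lemma card_pred_sum (A B : finType) (Q : pred (A + B)) :
  #|Q| = #|[pred x | Q (inl x)]| + #|[pred y | Q (inr y)]|.
Proof. by rewrite -!sum1_card big_sumType. Qed.

(** Below an event of [M2] lie all events of [M1] on its process; their number is even, so parity is
    kept. *)
Lemma alternating_seq (M1 M2 : bMSC P C) : even_msc M1 ->
  alternating_msc M1 -> alternating_msc M2 -> alternating_msc (bmsc_seq M1 M2).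
Proof.
move=> E1 A1 A2 [e|e]; rewrite card_pred_sum oddD.
  by rewrite /= A1 [X in _ = _ (+) odd X]eq_card0 // addbF.
by rewrite /= A2 [X in X (+) _](negPf (E1 (proc M2 e))).
Qed.

End AlternatingWords.

(** * Cutting runs, and local-choice graphs with alternating words *)

Section Paths.
Variables P C : finType.
Implicit Type G : MSG P C.

Lemma card_event_path G s r :
  #|event (path_label s r)| = \sum_(t <- s :: r) #|event (label G t)|.
Proof.
elim: r s => [|t r IHr] s; first by rewrite big_seq1.
by rewrite big_cons -IHr /= card_sum.
Qed.

(** This cuts a run at a node: the word of the second part is prescribed, and some word of the first
    part is put before it. *)
Lemma linearization_path_cat G s r s1 r1 w1 :
  linearization (@path_label _ _ G s1 r1) w1 ->
  exists w, linearization (path_label s r) w /\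
    linearization (path_label s (r ++ s1 :: r1)) (w ++ w1).
Proof.
move=> l1; elim: r s => [|t r IHr] s.
  have [w lw] := linearization_exists (label G s).
  by exists w; split=> //; apply: linearization_seq.
have [w [lw lww]] := IHr t; have [w0 lw0] := linearization_exists (label G s).
exists (w0 ++ w); rewrite -catA; split; exact: linearization_seq.
Qed.

Lemma other_process (M : bMSC P C) (e : event M) : exists f, proc M f != proc M e.
Proof.
have [se|/senderP [sf Ef]] := boolP (is_send M e).
  by exists (msg M e); rewrite eq_sym msg_proc.
by exists (sender e); rewrite -{2}Ef msg_proc.
Qed.

Lemma alternating_no_choice G : (forall w, language G w -> alternating w) ->
  local_choice G -> forall u : state G, ~~ choice_node u.
Proof.
move=> A LCG u; apply/negP => /LCG [p trig].
have [s1 [r1 [us1 pr1 [e _]]]] := (trig p).2 erefl.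
have /connectP [r pr Er] := init_reach u.
(* The triggering path is prolonged to the final state, since alternation is known only for words of
   complete runs. *)
have /connectP [r2 pr2 Er2] := final_reach (last s1 r1).
have path12 : path (edge G) s1 (r1 ++ r2) by rewrite cat_path pr1.
have [w2 lw2] := linearization_exists (path_label s1 (r1 ++ r2)).
have [w1 [lw1 lw]] := linearization_path_cat (init G) r lw2.
have Aw : alternating (w1 ++ w2).
  apply: A; exists (r ++ s1 :: r1 ++ r2); split=> //.
    by rewrite cat_path pr /= -Er us1.
  by rewrite last_cat /= last_cat -Er2.
have init2 := alternating_initiates lw2
  (alternating_suffix Aw (linearization_balanced lw1)).
have: 0 < #|event (path_label s1 (r1 ++ r2))|.
  rewrite card_event_path -cat_cons big_cat /= -card_event_path.
  by rewrite ltn_addr //; apply/card_gt0P; exists e.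
case/card_gt0P => f _; have [g /eqP []] := other_process f.
(* Every event of the part after the cut lies on an initiating process, hence on the single trigger
   [p]; but a message involves two processes. *)
have trigE h : proc (path_label s1 (r1 ++ r2)) h = p.
  by apply/trig; exists s1, (r1 ++ r2).
by rewrite !trigE.
Qed.

Lemma no_choice_run_unique G : (forall u : state G, ~~ choice_node u) ->
  forall s r r', path (edge G) s r -> last s r = final G ->
    path (edge G) s r' -> last s r' = final G -> r = r'.
Proof.
move=> nc s r; elim: r s => [|t r IHr] s [|t' r'] //=.
- by move=> _ -> /andP[]; rewrite (negPf (final_no_out _)).
- by move=> /andP[st _] _ _ Es; rewrite Es (negPf (final_no_out _)) in st.
move=> /andP[st pr] lr /andP[st' pr'] lr'.
have Et : t = t'.
  by apply/eqP; have := nc s; apply: contraR => ne; apply/card_gt1P; exists t, t'.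
by subst t'; rewrite (IHr t r').
Qed.

Lemma no_choice_size G w w' : (forall u : state G, ~~ choice_node u) ->
  language G w -> language G w' -> size w = size w'.
Proof.
move=> nc [r [pr lr lw]] [r' [pr' lr' lw']].
rewrite (size_linearization lw) (size_linearization lw').
by rewrite (no_choice_run_unique nc pr lr pr' lr').
Qed.

End Paths.

(** * The crossing bMSC and graphs labelled by it *)

Section Crossing.
Variables (P C : finType) (a b : P) (c : C).
Hypothesis ab : a != b.

(* The event [(x, t)] is the send ([t = true]) or the receive on the process
   that [x] selects. *)
Definition cross_proc (e : bool * bool) : P := if e.1 then a else b.
Definition cross_send (e : bool * bool) : bool := e.2.
Definition cross_msg (e : bool * bool) : bool * bool := (~~ e.1, false).
Definition cross_ple (e f : bool * bool) : bool := (e.1 == f.1) && (f.2 ==> e.2).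

Lemma cross_msg_recv e : cross_send e -> ~~ cross_send (cross_msg e).
Proof. by []. Qed.

Lemma cross_msg_inj : {in cross_send &, injective cross_msg}.
Proof. by move=> [[] []] [[] []]. Qed.

Lemma cross_msg_surj f : ~~ cross_send f -> exists2 e, cross_send e & cross_msg e = f.
Proof. by case: f => x [] // _; exists (~~ x, true); rewrite // /cross_msg negbK. Qed.

Lemma cross_proc_inj e f : cross_proc e = cross_proc f -> e.1 = f.1.
Proof.
by case: e f => [[] t] [[] t'] //= E; move: ab;
  rewrite /cross_proc /= in E; rewrite E eqxx.
Qed.

Lemma cross_msg_proc e : cross_send e -> cross_proc e != cross_proc (cross_msg e).
Proof. by case: e => [[] t] _; rewrite /cross_proc //= eq_sym. Qed.

Lemma cross_ple_proc e f : cross_ple e f -> cross_proc e = cross_proc f.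
Proof. by rewrite /cross_proc => /andP[/eqP -> _]. Qed.

Lemma cross_ple_total e f : cross_proc e = cross_proc f -> cross_ple e f || cross_ple f e.
Proof.
move=> /cross_proc_inj; case: e f => [x t] [y t'] /= ->.
by rewrite /cross_ple eqxx; case: t t' => [] [].
Qed.

Lemma cross_ple_anti : antisymmetric cross_ple.
Proof. by move=> [[] []] [[] []]. Qed.

Lemma cross_ple_trans : transitive cross_ple.
Proof. by move=> [[] []] [[] []] [[] []]. Qed.

Lemma cross_visual_anti : antisymmetric (visual_order cross_send cross_msg cross_ple).
Proof.
(* Two distinct comparable events are a send below a receive, so no cycle is possible. *)
have step e f : visual_order cross_send cross_msg cross_ple e f -> e = f \/ e.2 && ~~ f.2.
  case/connectP => p; elim: p e => [|g p IHp] e /=; first by left.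
  move=> /andP[eg /IHp IH] /IH {IHp IH}.
  by case: e g f eg => [[] []] [[] []] [[] []] //= _ []; auto.
move=> e f /andP[/step [// | /andP[_ f2]] /step [// | /andP[f2' _]]].
by rewrite f2' in f2.
Qed.

Lemma cross_fifo e e' : cross_send e -> cross_send e' -> cross_ple e e' ->
  cross_proc (cross_msg e) = cross_proc (cross_msg e') ->
  cross_ple (cross_msg e) (cross_msg e').
Proof. by move=> _ _ /andP[/eqP E _] _; rewrite /cross_ple /= E eqxx. Qed.

Definition crossing : bMSC P C :=
  BMSC (fun=> c) cross_msg_recv cross_msg_inj cross_msg_surj cross_msg_proc
    cross_ple_proc cross_ple_total cross_ple_anti cross_ple_trans
    cross_visual_anti cross_fifo.

Lemma crossing_alternating : alternating_msc crossing.
Proof.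
move=> [x t] /=; rewrite -sum1_card big_mkcond.
rewrite (eq_bigr (fun e => cross_ple (e.1, e.2) (x, t) : nat)); last first.
  by move=> [x1 t1] _; rewrite inE /=; case: cross_ple.
rewrite -(pair_bigA _ (fun i j => cross_ple (i, j) (x, t) : nat)) /= !big_bool /=.
by case: x t => [] [].
Qed.

Lemma crossing_even : even_msc crossing.
Proof.
move=> x /=; rewrite -sum1_card big_mkcond.
rewrite (eq_bigr (fun e => cross_proc (e.1, e.2) == x : nat)); last first.
  by move=> [x1 t1] _; rewrite inE /=; case: eqP.
rewrite -(pair_bigA _ (fun i j => cross_proc (i, j) == x : nat)) /= !big_bool /=.
by rewrite /cross_proc /=; do 2 case: eqP.
Qed.

Lemma crossings_alternating (G : MSG P C) (s : state G) r :
  (forall t, label G t = crossing) -> alternating_msc (path_label s r).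
Proof.
move=> L; elim: r s => [|t r IHr] s /=; rewrite L; first exact: crossing_alternating.
by apply: alternating_seq => //; [apply: crossing_even | apply: crossing_alternating].
Qed.

(** All events lie on [a] or [b], so these are the only possible triggers. The first send of [a] is
    below itself and below its receive on [b]. *)
Lemma crossings_controllable (G : MSG P C) :
  (forall t, label G t = crossing) -> controllable_choice G.
Proof.
move=> L u _; right.
have procs (s : state G) r (e : event (path_label s r)) :
    exists x, proc (path_label s r) e = cross_proc (x, true).
  elim: r s e => [|t r IHr] s /=; rewrite L; first by move=> [x ?]; exists x.
  by move=> [[x ?]|e]; [exists x | apply: IHr].
have res (s : state G) r : exists e, @resolving _ _ (path_label s r) (triggers u) e.
  have two (M : bMSC P C) e : is_send M e -> proc M e = a -> proc M (msg M e) = b ->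
      resolving (triggers u) e.
    move=> se ea eb; split=> // p [s1 [r1 [_ _ [f [<- _]]]]].
    have [[] ->] := procs _ _ f.
      by exists e; split=> //; apply: connect0.
    by exists (msg M e); split=> //; apply: msg_vle.
  case: r => [|t r] /=; rewrite L; first by exists (true, true); apply: two.
  by exists (inl (true, true)); apply: two.
by split=> *; apply: res.
Qed.

End Crossing.

(** * A graph with exactly two runs, through two and three states *)

Section ThreeStates.
Variables (P C : finType) (M : bMSC P C).

Definition lt3 : rel 'I_3 := fun i j => i < j.

Lemma lt3_init s : ~~ lt3 s ord0. Proof. by []. Qed.

Lemma lt3_final s : ~~ lt3 ord_max s.
Proof. by rewrite /lt3 -leqNgt -ltnS. Qed.

Lemma lt3_init_reach s : connect lt3 ord0 s.
Proof.
have [->|s0] := eqVneq s ord0; first exact: connect0.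
by apply: connect1; rewrite /lt3 lt0n.
Qed.

Lemma lt3_final_reach s : connect lt3 s ord_max.
Proof.
have [->|s2] := eqVneq s ord_max; first exact: connect0.
by apply: connect1; rewrite /lt3 ltn_neqAle s2 -ltnS ltn_ord.
Qed.

Definition two_or_three : MSG P C :=
  Msg (fun=> M) lt3_init lt3_final lt3_init_reach lt3_final_reach.

Lemma two_or_three_sizes : exists w w', [/\ language two_or_three w,
  language two_or_three w', size w = 2 * #|event M| & size w' = 3 * #|event M|].
Proof.
have [w lw] := linearization_exists (@path_label _ _ two_or_three ord0 [:: ord_max]).
have [w' lw'] := linearization_exists
  (@path_label _ _ two_or_three ord0 [:: inord 1; ord_max]).
exists w, w'; split.
- by exists [:: ord_max].
- by exists [:: inord 1; ord_max]; split=> //=; rewrite /lt3 !inordK.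
- by rewrite (size_linearization lw) card_event_path !big_cons big_nil /=; lia.
- by rewrite (size_linearization lw') card_event_path !big_cons big_nil /=; lia.
Qed.

End ThreeStates.

(** * The inclusion and its strictness *)

Theorem theorem1 (P C : finType) :
  (forall G : MSG P C, LC G -> CC G) /\
  (1 < #|P| -> 0 < #|C| -> exists G : MSG P C, CC G /\ ~ LC G).
Proof.
split=> [G [G' [lc sl]]|/card_gt1P [a [b [_ _ ab]]] /card_gt0P [c _]].
  by exists G'; split=> // u /lc; left.
exists (two_or_three (crossing c ab)); split.
  exists (two_or_three (crossing c ab)); split=> //.
  exact: (crossings_controllable (c := c) (ab := ab)).
move=> [G' [lc sl]].
have A w : language G' w -> alternating w.
  move=> /sl [r [_ _ lw]]; apply: alternating_linearization lw.
  exact: (crossings_alternating (c := c) (ab := ab)).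
have nc := alternating_no_choice A lc.
have [w [w' [/sl lw /sl lw' sw sw']]] := two_or_three_sizes (crossing c ab).
(* Equal sizes would give 2 * 4 = 3 * 4, as the crossing bMSC has four events. *)
have := no_choice_size nc lw lw'; rewrite sw sw' => /eqP.
by rewrite eqn_mul2r card_prod !card_bool.
Qed.
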